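(* $\mathfrak{Dau}(\ell_\infty/c_0)=\mathfrak{r}$.
   Context: All Banach spaces are real; $\ell_\infty/c_0$ carries the quotient norm. $B_X$ and $S_X$ denote the closed unit ball and unit sphere of a Banach space $X$. A slice of $B_X$ is a nonempty intersection of $B_X$ with an open half-space, i.e. a set $\{x\in B_X: f(x)>\sup f(B_X)-\alpha\}$ with $f\in X^*$, $\alpha>0$. For a cardinal $\kappa$, $\{y_\alpha:\alpha<\kappa\}$ denotes a set of cardinality at most $\kappa$. $X$ has the $\kappa$-Daugavet property if for every family $\{y_\alpha:\alpha<\kappa\}\subseteq S_X$, every slice $S$ of $B_X$ and every $\varepsilon>0$ there is $x\in S$ with $\|y_\alpha+x\|>2-\varepsilon$ for all $\alpha<\kappa$. For nonzero $X$, $\mathfrak{Dau}(X)$ is the least cardinal $\kappa$ such that $X$ fails the $\kappa$-Daugavet property. The cardinal $\mathfrak{r}$ (the reaping number) is the reaping number of the Boolean algebra $\mathcal{P}(\omega)/\mathit{fin}$ of subsets of the natural numbers modulo finite sets, where the reaping number of a Boolean algebra $\mathbb{B}$ is the least cardinality of a subset $X\subseteq\mathbb{B}\setminus\{0\}$ such that every $a\in\mathbb{B}$ either contains an element of $X$ or is disjoint from an element of $X$. Equivalently, it is the least cardinality of a family of infinite subsets of $\omega$ such that every infinite subset of $\omega$ either contains, modulo a finite set, a member of the family or is disjoint, modulo a finite set, from a member of the family. *)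

(* Defs.v *)
From HB Require Import structures.
From mathcomp Require Import all_boot all_order all_algebra.
From mathcomp Require Import all_classical all_reals all_analysis.

Set Implicit Arguments.
Unset Strict Implicit.
Unset Printing Implicit Defensive.

Import Order.TTheory GRing.Theory Num.Theory.
Import numFieldNormedType.Exports.
Local Open Scope classical_set_scope.
Local Open Scope ring_scope.
Local Open Scope card_scope.
Local Open Scope quotient_scope.

(* A cardinal is an equipotence class of types; two sets have the same
   [card] iff they are equipotent (lemma [card_inj]). *)
Record cardinal := Cardinal {
  equipotent_types : Type -> Prop;
  _ : exists K : Type, equipotent_types = (fun L => [set: L] #= [set: K]) }.

Lemma equipotent_classP (T : Type) (A : set T) :
  exists K : Type, (fun L : Type => [set: L] #= A : Prop) =
                   (fun L => [set: L] #= [set: K]).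
Proof.
by exists A; apply/funext => L; rewrite (card_eqr (card_setT A)).
Qed.

Definition card (T : Type) (A : set T) : cardinal :=
  Cardinal (equipotent_classP A).

Definition cardinal_le (c d : cardinal) : Prop :=
  exists K L : Type,
    [/\ c = card [set: K], d = card [set: L] & [set: K] #<= [set: L]].

Definition is_least_cardinal (P : cardinal -> Prop) (c : cardinal) : Prop :=
  P c /\ forall d, P d -> cardinal_le c d.

Lemma cardinal_eq (c d : cardinal) :
  equipotent_types c = equipotent_types d -> c = d.
Proof.
case: c d => [C CP] [D DP] /= CD; subst D.
by congr Cardinal; exact: Prop_irrelevance.
Qed.

Lemma cardinal_surj (c : cardinal) : exists K : Type, c = card [set: K].
Proof. by case: c => C [K CK]; exists K; exact: cardinal_eq. Qed.

Lemma card_inj (T U : Type) (A : set T) (B : set U) :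
  card A = card B <-> A #= B.
Proof.
split=> [/(congr1 (fun c => equipotent_types c A))/= AB|AB].
  have : [set: A] #= A by exact: card_setT.
  rewrite AB => /card_esym AB'.
  exact/card_esym/(card_eq_trans AB')/card_setT.
by apply: cardinal_eq; apply/funext => L /=; rewrite (card_eqr AB).
Qed.

Lemma cardinal_le_card (T U : Type) (A : set T) (B : set U) :
  cardinal_le (card A) (card B) <-> A #<= B.
Proof.
split=> [[K [L [/card_inj AK /card_inj BL KL]]]|AB].
  by rewrite (card_le_eql AK) (card_le_eqr BL).
exists A, B; split; try exact/card_inj/card_setT_sym.
by rewrite (card_le_eql (card_setT A)) (card_le_eqr (card_setT B)).
Qed.

Lemma inj_card_leP (K L : Type) :
  [set: K] #<= [set: L] <-> exists f : K -> L, injective f.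
Proof.
split=> [/card_leP[f]|[f injf]].
  exists (fun x => val (f (SigSub (mem_set (I : [set: K] x))))) => x y.
  move=> /val_inj H.
  have : {in [set: [set: K]] &, injective f} by exact: inj.
  by move=> /(_ _ _ (mem_set I) (mem_set I) H) /(congr1 val).
have [|g] := (injfunPex (A := [set: K]) (B := [set: L])).2; last first.
  exact: inj_card_le g.
by exists f => // x y _ _ /injf.
Qed.

Lemma inj_family_min (J : Type) (T : J -> Type) (j0 : J) :
  exists i, forall j, exists f : T i -> T j, injective f.
Proof.
pose good (S : set (forall j, T j)) :=
  forall j x y, S x -> S y -> x j = y j -> x = y.
have [F Fgood tot|S [Sgood Smax]] := @Zorn_bigcup (forall j, T j) good.
  move=> j x y [A FA Ax] [B FB By].
  have [AB|BA] := tot _ _ FA FB.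
    by apply: (Fgood _ FB) => //; exact: AB.
  by apply: (Fgood _ FA) => //; exact: BA.
have [i Si] : exists i, forall t : T i, exists2 x, S x & x i = t.
  apply: contrapT => /forallNP noi.
  have x0P j : exists t : T j, forall x, S x -> x j <> t.
    have /existsNP[t tP] := noi j; exists t => x Sx xt.
    by apply: tP; exists x.
  pose x0 j := projT1 (cid (x0P j)).
  have x0S j x : S x -> x j <> x0 j by exact: (projT2 (cid (x0P j))).
  apply: (Smax (S `|` [set x0])).
    split; first by move=> x Sx; left.
    by move=> /(_ x0 (or_intror erefl)) /(x0S j0).
  - move=> j x y [Sx|->] [Sy|->] //; first exact: Sgood.
    + by move=> /(x0S j x Sx).
    + by move=> /esym /(x0S j y Sy).
exists i => j.
pose h (t : T i) := projT1 (cid2 (Si t)).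
have hS t : S (h t) by rewrite /h; case: cid2.
have hi t : h t i = t by rewrite /h; case: cid2.
exists (fun t => h t j) => t u tu.
by rewrite -[t]hi -[u]hi (Sgood _ _ _ (hS t) (hS u) tu).
Qed.

Lemma ex_least_cardinal (P : cardinal -> Prop) :
  (exists c, P c) -> exists c, is_least_cardinal P c.
Proof.
case=> c Pc; have [K cK] := cardinal_surj c; rewrite {c}cK in Pc.
pose J := {A : set K | P (card A)}.
have [[A PA] minA] :=
  @inj_family_min J (fun A => set_type (sval A)) (exist _ _ Pc).
have AT (U : Type) (B : set U) (f : A -> B) : injective f -> A #<= B.
  move=> injf; rewrite -(card_le_eql (card_setT A)) -(card_le_eqr (card_setT B)).
  by apply/inj_card_leP; exists f.
exists (card A); split=> // d Pd.
have [L dL] := cardinal_surj d; rewrite {d}dL in Pd *.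
apply/cardinal_le_card.
have [b bP] := @inj_family_min bool (fun b => if b then A : Type else L) true.
rewrite -(card_le_eql (card_setT A)).
case: b bP => bP; first by apply/inj_card_leP; exact: (bP false).
have [f injf] := bP true.
pose g (l : L) : K := val (f l).
have LB : range g #= [set: L].
  by apply: inj_card_eq => x y _ _ /val_inj/injf.
have PB : P (card (range g)).
  by rewrite (_ : card _ = card [set: L]) //; exact/card_inj.
have [h injh] := minA (exist _ _ PB).
by rewrite -(card_le_eqr LB) (card_le_eql (card_setT A)); exact: AT injh.
Qed.

(* [card set0] is a default value, for P empty. *)
Definition least_cardinal (P : cardinal -> Prop) : cardinal :=
  if pselect (exists c, P c) is left exP
  then projT1 (cid (ex_least_cardinal exP)) else card (@set0 unit).

Lemma least_cardinalP (P : cardinal -> Prop) :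
  (exists c, P c) -> is_least_cardinal P (least_cardinal P).
Proof.
by rewrite /least_cardinal; case: pselect => // exP _; exact: projT2 (cid _).
Qed.

Section Daugavet.
Variables (R : realType) (X : normedModType R).

Definition unit_ball : set X := [set x | `|x| <= 1].

Definition unit_sphere : set X := [set x | `|x| = 1].

(* f = 0 gives the whole ball. *)
Definition slice_of_ball (f : X -> R) (a : R) : set X :=
  [set x | unit_ball x /\ sup (f @` unit_ball) - a < f x].

Definition is_slice (S : set X) : Prop :=
  exists (f : {linear X -> R^o}) (a : R),
    [/\ continuous f, 0 < a & S = slice_of_ball f a].

(* The sets Y with [card Y <= kappa] are the families {y_alpha : alpha < kappa}. *)
Definition Daugavet_property (kappa : cardinal) : Prop :=
  forall Y : set X, Y `<=` unit_sphere -> cardinal_le (card Y) kappa ->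
  forall S : set X, is_slice S ->
  forall e : R, 0 < e ->
  exists2 x, S x & forall y, Y y -> 2 - e < `|y + x|.

(* Meaningful for X nonzero: for X = 0 the property never fails and [Dau] is
   the default value of [least_cardinal]. *)
Definition Dau : cardinal :=
  least_cardinal (fun kappa => ~ Daugavet_property kappa).

End Daugavet.

Section EllInfinity.
Variable R : realType.

Definition bounded_seq : {pred (nat -> R)} :=
  [pred u | `[< bounded_fun u >]].

Lemma bounded_seqP (u : nat -> R) :
  reflect (exists M, forall n, `|u n| <= M) (u \in bounded_seq).
Proof.
apply: (iffP (asboolP _)) => [|[M uM]].
  by move=> [M [_ /(_ (M + 1))]]; rewrite ltrDl ltr01 => uM; exists (M + 1) => n; exact: uM.
exists M; split; first exact: num_real.
by move=> N MN n _ /=; rewrite (le_trans (uM n))// ltW.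
Qed.

Lemma bounded_seq_submod_closed : submod_closed bounded_seq.
Proof.
split; first by apply/bounded_seqP; exists 0 => n; rewrite normr0.
move=> a u v /bounded_seqP[M uM] /bounded_seqP[N vN].
apply/bounded_seqP; exists (`|a| * M + N) => n.
apply: (le_trans (ler_normD _ _)); apply: lerD => //.
by rewrite normrM ler_wpM2l.
Qed.

HB.instance Definition _ := GRing.isSubmodClosed.Build R (nat -> R)
  bounded_seq bounded_seq_submod_closed.

Record linf := Linf { linf_seq :> nat -> R ; _ : linf_seq \in bounded_seq }.

HB.instance Definition _ := [isSub for linf_seq].
HB.instance Definition _ := [Choice of linf by <:].
HB.instance Definition _ := [SubChoice_isSubLmodule of linf by <:].

Definition sup_norm (x : linf) : R := sup [set `|x n| | n in [set: nat]].

Lemma sup_norm_ub (x : linf) n : `|x n| <= sup_norm x.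
Proof.
apply: ub_le_sup; last by exists n.
by have /bounded_seqP[M xM] := valP x; exists M => _ [k _ <-].
Qed.

Lemma sup_norm_le (x : linf) M : (forall n, `|x n| <= M) -> sup_norm x <= M.
Proof.
move=> xM; apply: ge_sup; first by exists `|x 0%N|, 0%N.
by move=> _ [n _ <-].
Qed.

Lemma sup_norm_triangle (x y : linf) :
  sup_norm (x + y) <= sup_norm x + sup_norm y.
Proof.
apply: sup_norm_le => n; apply: (le_trans (ler_normD _ _)).
by apply: lerD; exact: sup_norm_ub.
Qed.

Lemma sup_normZ (a : R) (x : linf) : sup_norm (a *: x) = `|a| * sup_norm x.
Proof.
have le b y : sup_norm (b *: y) <= `|b| * sup_norm y.
  apply: sup_norm_le => n /=; rewrite normrM.
  by rewrite ler_wpM2l// sup_norm_ub.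
apply/eqP; rewrite eq_le le /=.
have [->|a0] := eqVneq a 0.
  by rewrite normr0 mul0r (le_trans _ (sup_norm_ub _ 0)).
rewrite -ler_pdivlMl ?normr_gt0// -normfV.
by apply: (le_trans _ (le _ _)); rewrite scalerA mulVf// scale1r.
Qed.

Lemma sup_norm0_eq0 (x : linf) : sup_norm x = 0 -> x = 0.
Proof.
move=> x0; apply/val_inj/funext => n; apply/eqP; rewrite -normr_le0 -x0.
exact: sup_norm_ub.
Qed.

HB.instance Definition _ := Lmodule_isNormed.Build R linf
  sup_norm_triangle sup_normZ sup_norm0_eq0.

Definition c0 : {pred linf} := [pred x : linf | `[< (x : nat -> R) @ \oo --> 0 >]].

Lemma c0P (x : linf) : reflect ((x : nat -> R) @ \oo --> 0) (x \in c0).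
Proof. exact: asboolP. Qed.

Lemma c0_submod_closed : submod_closed c0.
Proof.
split; first by apply/c0P; exact: cvg_cst.
move=> a x y /c0P x0 /c0P y0; apply/c0P.
have := cvgD (cvgM (cvg_cst a) x0) y0.
rewrite mulr0 addr0; exact.
Qed.

HB.instance Definition _ := GRing.isSubmodClosed.Build R linf
  c0 c0_submod_closed.

Definition linf_mod_c0 : Type := Quotient.quot c0.

HB.instance Definition _ := GRing.Zmodule.on linf_mod_c0.
HB.instance Definition _ := EqQuotient.on linf_mod_c0.

Local Notation Q := linf_mod_c0.
Local Notation pi := (\pi_Q : linf -> Q).

Lemma pi_eqP (x y : linf) : reflect (pi x = pi y) (x - y \in c0).
Proof. by rewrite Quotient.idealrBE; exact: eqP. Qed.

Lemma piD (x y : linf) : pi (x + y) = pi x + pi y.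
Proof. exact: Quotient.pi_add. Qed.

Lemma pi0 : pi 0 = 0.
Proof. by apply: (addrI (pi 0)); rewrite -piD !addr0. Qed.

Definition quot_scale (a : R) (q : Q) : Q := pi (a *: repr q).

Lemma quot_scale_pi a x : quot_scale a (pi x) = pi (a *: x).
Proof.
apply/pi_eqP; rewrite -scalerBr rpredZ//; apply/pi_eqP; exact: reprK.
Qed.

Let quotP (P : Q -> Prop) : (forall x, P (pi x)) -> forall q, P q.
Proof. by move=> Px q; rewrite -[q]reprK; exact: Px. Qed.

Fact quot_scalerA a b q : quot_scale a (quot_scale b q) = quot_scale (a * b) q.
Proof. by elim/quotP: q => x; rewrite !quot_scale_pi scalerA. Qed.

Fact quot_scale1r : left_id 1 quot_scale.
Proof. by elim/quotP => x; rewrite quot_scale_pi scale1r. Qed.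

Fact quot_scalerDr : right_distributive quot_scale +%R.
Proof.
move=> a; elim/quotP => x; elim/quotP => y.
by rewrite -piD !quot_scale_pi scalerDr piD.
Qed.

Fact quot_scalerDl q : {morph quot_scale^~ q : a b / a + b}.
Proof.
by elim/quotP: q => x a b; rewrite !quot_scale_pi scalerDl piD.
Qed.

HB.instance Definition _ := GRing.Zmodule_isLmodule.Build R Q
  quot_scalerA quot_scale1r quot_scalerDr quot_scalerDl.

(* The infimum over a coset of c0, i.e. the distance to c0 of any element. *)
Definition quot_norm (q : Q) : R :=
  inf [set `|x| | x in [set x : linf | pi x = q]].

Let lbq (q : Q) : has_lbound [set `|x| | x in [set x : linf | pi x = q]].
Proof. by exists 0 => _ [x _ <-]; exact: normr_ge0. Qed.

Lemma quot_norm_le x : quot_norm (pi x) <= `|x|.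
Proof. by apply: ge_inf; [exact: lbq|exists x]. Qed.

Lemma quot_norm_ge q M :
  (forall x, pi x = q -> M <= `|x|) -> M <= quot_norm q.
Proof.
move=> qM; apply: lb_le_inf.
  by exists `|repr q|, (repr q) => //=; exact: reprK.
by move=> _ [x /= xq <-]; exact: qM.
Qed.

Lemma quot_norm_ge0 q : 0 <= quot_norm q.
Proof. exact: quot_norm_ge. Qed.

Lemma quot_norm_triangle (p q : Q) :
  quot_norm (p + q) <= quot_norm p + quot_norm q.
Proof.
rewrite -lerBlDr; apply: quot_norm_ge => x xp.
rewrite lerBlDr -lerBlDl; apply: quot_norm_ge => y yq.
rewrite lerBlDl -xp -yq -piD (le_trans (quot_norm_le _))//.
exact: ler_normD.
Qed.

Lemma quot_normZ (a : R) (q : Q) : quot_norm (a *: q) = `|a| * quot_norm q.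
Proof.
have piZ b x : pi (b *: x) = b *: pi x by rewrite -quot_scale_pi.
have le b p : b != 0 -> quot_norm (b *: p) <= `|b| * quot_norm p.
  move=> b0; rewrite -ler_pdivrMl ?normr_gt0//.
  apply: quot_norm_ge => x <-; rewrite ler_pdivrMl ?normr_gt0//.
  by rewrite -normrZ -piZ quot_norm_le.
have [->|a0] := eqVneq a 0.
  rewrite normr0 mul0r scale0r; apply/eqP; rewrite eq_le quot_norm_ge0 andbT.
  by rewrite -pi0 (le_trans (quot_norm_le _))// normr0.
apply/eqP; rewrite eq_le le//=.
rewrite -ler_pdivlMl ?normr_gt0// -normfV.
apply: (le_trans _ (le _ _ _)); rewrite ?invr_eq0//.
by rewrite scalerA mulVf// scale1r.
Qed.

Lemma quot_norm0_eq0 q : quot_norm q = 0 -> q = 0.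
Proof.
elim/quotP: q => x x0.
rewrite -pi0; apply/pi_eqP; rewrite subr0; apply/c0P/cvgrPdist_lt => e e0.
have [_ [y /= yx <-] ye] : exists2 r,
    [set `|y| | y in [set y : linf | pi y = pi x]] r & r < e / 2.
  apply: inf_lt; first by exists `|x|, x.
  by rewrite -/(quot_norm (pi x)) x0 divr_gt0.
have /pi_eqP/c0P/cvgrPdist_lt/(_ (e / 2)) := esym yx.
rewrite divr_gt0// => /(_ isT); apply: filterS => n.
rewrite !sub0r !normrN => xy.
rewrite -[x n](subrK (y n)) (le_lt_trans (ler_normD _ _))// (splitr e) ltrD//.
exact: le_lt_trans (sup_norm_ub y n) ye.
Qed.

HB.instance Definition _ := Lmodule_isNormed.Build R Q
  quot_norm_triangle quot_normZ quot_norm0_eq0.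

End EllInfinity.

(* [ctbDistrLatticeType], bounded complemented distributive lattices, are
   the Boolean algebras. *)
Definition is_reaping d (B : ctbDistrLatticeType d) (X : set B) : Prop :=
  ~ X \bot%O /\
  forall a : B, exists2 x, X x & (x <= a)%O \/ (a `&` x)%O = \bot%O.

Definition reaping_number_of d (B : ctbDistrLatticeType d) : cardinal :=
  least_cardinal (fun kappa => exists2 X : set B, is_reaping X & card X = kappa).

Section PowersetModFin.

Definition eq_mod_fin (A B : set nat) : bool :=
  `[< finite_set ((A `\` B) `|` (B `\` A)) >].

Lemma eq_mod_finP (A B : set nat) :
  reflect (exists N, forall n, (N <= n)%N -> (A n <-> B n)) (eq_mod_fin A B).
Proof.
apply: (iffP (asboolP _)) => [/finite_seqP[s sE]|[N NP]].
  exists (\max_(i <- s) i).+1 => n Nn.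
  have sn : ~ (n \in s).
    by move=> ns; move: Nn; rewrite ltnNge leq_bigmax_seq.
  have {}sn : ~ ((A `\` B) `|` (B `\` A)) n by rewrite sE.
  split=> Hn; apply: contrapT => Hn'; apply: sn; [by left|by right].
apply: (@sub_finite_set _ _ `I_N); last exact: finite_II.
by move=> n ABn /=; rewrite ltnNge; apply/negP => /NP; case: ABn => -[]; tauto.
Qed.

Fact eq_mod_fin_equiv : equiv_class_of eq_mod_fin.
Proof.
split=> [A|A B|B A C].
- by apply/eq_mod_finP; exists 0%N.
- by apply/eq_mod_finP/eq_mod_finP => -[N NP]; exists N => n /NP; tauto.
- move=> /eq_mod_finP[N NP] /eq_mod_finP[M MP]; apply/eq_mod_finP.
  by exists (maxn N M) => n; rewrite geq_max => /andP[/NP + /MP]; tauto.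
Qed.

Canonical eq_mod_fin_equiv_rel := EquivRelPack eq_mod_fin_equiv.
Canonical eq_mod_fin_enc_mod_rel := defaultEncModRel eq_mod_fin.

Definition Pomega_fin : Type := {eq_quot eq_mod_fin}.

HB.instance Definition _ := Choice.on Pomega_fin.
HB.instance Definition _ := EqQuotient.on Pomega_fin.

Local Notation Q := Pomega_fin.
Local Notation pi := (\pi_Q : set nat -> Q).

Lemma pi_finP (A B : set nat) :
  pi A = pi B <-> exists N, forall n, (N <= n)%N -> (A n <-> B n).
Proof.
split=> [/eqP|] AB; last by apply/eqP; rewrite piE; apply/eq_mod_finP.
by apply/eq_mod_finP; rewrite -eqmodE.
Qed.

Definition fmeet (p q : Q) : Q := pi (repr p `&` repr q).
Definition fjoin (p q : Q) : Q := pi (repr p `|` repr q).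
Definition fcompl (p : Q) : Q := pi (~` repr p).
Definition fle (p q : Q) : bool := fmeet p q == p.
Definition flt (p q : Q) : bool := (q != p) && fle p q.

Let reprP A : exists N, forall n, (N <= n)%N -> (repr (pi A) n <-> A n).
Proof. by apply/pi_finP; exact: reprK. Qed.

Lemma fmeet_pi A B : fmeet (pi A) (pi B) = pi (A `&` B).
Proof.
have [N NP] := reprP A; have [M MP] := reprP B; apply/pi_finP.
exists (maxn N M) => n; rewrite geq_max => /andP[/NP + /MP].
by rewrite /setI /mkset; tauto.
Qed.

Lemma fjoin_pi A B : fjoin (pi A) (pi B) = pi (A `|` B).
Proof.
have [N NP] := reprP A; have [M MP] := reprP B; apply/pi_finP.
exists (maxn N M) => n; rewrite geq_max => /andP[/NP + /MP].
by rewrite /setU /mkset; tauto.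
Qed.

Lemma fcompl_pi A : fcompl (pi A) = pi (~` A).
Proof.
have [N NP] := reprP A; apply/pi_finP; exists N => n /NP.
by rewrite /setC /mkset; tauto.
Qed.

Let quotP (P : Q -> Prop) : (forall A, P (pi A)) -> forall q, P q.
Proof. by move=> PA q; rewrite -[q]reprK; exact: PA. Qed.

Fact fmeetC : commutative fmeet.
Proof. by elim/quotP => A; elim/quotP => B; rewrite !fmeet_pi setIC. Qed.

Fact fjoinC : commutative fjoin.
Proof. by elim/quotP => A; elim/quotP => B; rewrite !fjoin_pi setUC. Qed.

Fact fmeetA : associative fmeet.
Proof.
by elim/quotP => A; elim/quotP => B; elim/quotP => C; rewrite !fmeet_pi setIA.
Qed.

Fact fjoinA : associative fjoin.
Proof.
by elim/quotP => A; elim/quotP => B; elim/quotP => C; rewrite !fjoin_pi setUA.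
Qed.

Fact fjoinKI q p : fmeet p (fjoin p q) = p.
Proof.
by elim/quotP: p => A; elim/quotP: q => B; rewrite fjoin_pi fmeet_pi setUC setKU.
Qed.

Fact fmeetKU q p : fjoin p (fmeet p q) = p.
Proof.
by elim/quotP: p => A; elim/quotP: q => B; rewrite fmeet_pi fjoin_pi setIC setKI.
Qed.

Fact fmeetUl : left_distributive fmeet fjoin.
Proof.
elim/quotP => A; elim/quotP => B; elim/quotP => C.
by rewrite !(fmeet_pi, fjoin_pi) setIUl.
Qed.

Fact fmeetxx : idempotent_op fmeet.
Proof. by elim/quotP => A; rewrite fmeet_pi setIid. Qed.

Fact Pomega_fin_display : Order.disp_t. Proof. exact: Order.Disp tt tt. Qed.

HB.instance Definition _ := Order.isMeetJoinDistrLattice.Build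
  Pomega_fin_display Q (fun _ _ => erefl) (fun _ _ => erefl)
  fmeetC fjoinC fmeetA fjoinA fjoinKI fmeetKU fmeetUl fmeetxx.

Fact fle0x (p : Q) : (pi set0 <= p)%O.
Proof. by elim/quotP: p => A; apply/eqP; rewrite fmeet_pi set0I. Qed.

Fact flex1 (p : Q) : (p <= pi setT)%O.
Proof. by elim/quotP: p => A; apply/eqP; rewrite fmeet_pi setIT. Qed.

HB.instance Definition _ := Order.hasBottom.Build Pomega_fin_display Q fle0x.
HB.instance Definition _ := Order.hasTop.Build Pomega_fin_display Q flex1.

Fact fjoinxC (p : Q) : (p `|` fcompl p = \top)%O.
Proof.
by elim/quotP: p => A; rewrite fcompl_pi; rewrite [LHS]fjoin_pi setUCr.
Qed.

Fact fmeetxC (p : Q) : (p `&` fcompl p = \bot)%O.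
Proof.
by elim/quotP: p => A; rewrite fcompl_pi; rewrite [LHS]fmeet_pi setICr.
Qed.

HB.instance Definition _ :=
  Order.TBDistrLattice_hasComplement.Build Pomega_fin_display Q
    fjoinxC fmeetxC.

End PowersetModFin.

Definition reaping_number : cardinal := reaping_number_of Pomega_fin.

(* Main.v *)
(* In l_infty/c_0 the norm is the limsup of absolute values.

   Dau <= r: if F is a reaping family and x in the ball satisfies |y + x| > 3/2
   for each of the vectors y = 1_A, -1_A with A in F, then [0 < x]
   splits every member of F, which is impossible; F being infinite, there are
   only |F| such vectors.

   r <= Dau: each unit vector y is close to some sign s_y on an infinite set
   A_y.  With fewer than r sets A_y, one colouring of the integers in 2m colours
   meets every A_y infinitely often in every colour.  Given u in the slice, change
   it to 1 and -1 on the two halves of one of m pairs of colours: the result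
   almost attains |y + x| = 2 for all y.  The m changes have disjoint supports, so
   a functional is small on one of them and the changed vector stays in the
   slice. *)
Require Import Defs.
From mathcomp Require Import all_boot all_order all_algebra.
From mathcomp Require Import all_classical all_reals all_analysis.
From mathcomp Require Import zify lra.

Set Implicit Arguments.
Unset Strict Implicit.
Unset Printing Implicit Defensive.

Import Order.TTheory GRing.Theory Num.Theory.
Import numFieldNormedType.Exports.
Local Open Scope classical_set_scope.
Local Open Scope ring_scope.
Local Open Scope card_scope.
Local Open Scope quotient_scope.

(** * Infinite sets and the doubling of an infinite cardinal *)

Lemma infinite_natP (A : set nat) :
  infinite_set A <-> forall N, exists2 n, (N <= n)%N & A n.
Proof.
split=> [Ainf N|Aub /finite_seqP[s As]].
  apply: contrapT => noN; apply: Ainf.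
  apply: (@sub_finite_set _ _ `I_N); last exact: finite_II.
  by move=> n An /=; rewrite ltnNge; apply/negP => Nn; apply: noN; exists n.
have [n + An] := Aub (\max_(i <- s) i).+1.
have ns : [set` s] n by rewrite -As.
by rewrite ltnNge leq_bigmax_seq.
Qed.

(** A maximal family of injective sequences with disjoint ranges misses only finitely many points,
    so [K] embeds into the pairs of a sequence and a position. Doubling the positions makes room for
    the boolean. *)
Lemma infinite_double (K : Type) :
  infinite_set [set: K] -> exists f : K * bool -> K, injective f.
Proof.
move=> Kinf.
(* The case [f = g] says that each sequence is injective. *)
pose disj (F : set (nat -> K)) :=
  forall f g m n, F f -> F g -> f m = g n -> f = g /\ m = n.
have [F0 F0P tot|F [Fdisj Fmax]] := @Zorn_bigcup (nat -> K) disj.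
  move=> f g m n [A FA Af] [B FB Bg].
  have [AB|BA] := tot _ _ FA FB.
    by apply: (F0P _ FB) => //; exact: AB.
  by apply: (F0P _ FA) => //; exact: BA.
pose U := [set x | exists f n, F f /\ f n = x].
(* An infinite complement would contain one more sequence, against maximality. *)
have UCfin : finite_set (~` U).
  apply: contrapT => /infiniteP; rewrite -(card_le_eqr (card_setT _)).
  move=> /inj_card_leP[e einj].
  have eU n : ~ U (val (e n)) by have /set_mem := valP (e n).
  have vinj m n : val (e m) = val (e n) -> m = n by move=> /val_inj/einj.
  apply: (Fmax (F `|` [set val \o e])).
    split; first by move=> f Ff; left.
    move=> /(_ (val \o e) (or_intror erefl)) Fe.
    by apply: (eU 0%N); exists (val \o e), 0%N.
  move=> f g m n [Ff|->] [Fg|->]; first exact: Fdisj.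
  - by move=> fe; exfalso; apply: (eU n); exists f, m.
  - by move=> eg; exfalso; apply: (eU m); exists g, n.
  - by move=> /vinj.
have [f0 Ff0] : exists f, F f.
  apply: contrapT => noF; apply: Kinf; move: UCfin.
  by rewrite (_ : ~` U = setT)// -subTset => x _ [f [n [Ff _]]]; apply: noF; exists f.
have /countable_injP[e einj] : countable (~` U) by exact: finite_set_countable.
(* The points outside U are absorbed by the sequence f0, whose own values
   are moved to the odd positions. *)
have code x : exists p : (nat -> K) * nat, F p.1 /\
    (odd p.2 /\ p.1 p.2./2 = x \/ [/\ ~~ odd p.2, ~ U x & e x = p.2./2]).
  have [[f [n [Ff fnx]]]|nUx] := pselect (U x).
    exists (f, n.*2.+1); split=> //; left.
    by rewrite /= odd_double uphalf_double.
  exists (f0, (e x).*2); split=> //; right.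
  by rewrite /= odd_double doubleK.
have [c cP] := choice code.
have cinj : injective c.
  move=> x y cxy; have [_ cx] := cP x; have [_ cy] := cP y.
  move: cx cy; rewrite cxy => -[[ox <-]|[/negbTE ox Ux ex]] [[oy yE]|[oy Uy ey]] //.
  - by rewrite ox in oy.
  - by rewrite ox in oy.
  - by apply: einj; rewrite ?ex ?ey//; apply/mem_set.
exists (fun xb : K * bool => (c xb.1).1 ((c xb.1).2.*2 + xb.2)%N) => -[x b] [y b'] /=.
have [Fx _] := cP x; have [Fy _] := cP y.
move=> /(Fdisj _ _ _ _ Fx Fy)[c1 c2].
have c3 : (c x).2 = (c y).2 by case: b b' c2 => [] []; lia.
have c4 : b = b' by case: b b' c2 => [] []; lia.
by rewrite c4 (cinj x y)// [c x]surjective_pairing c1 c3 -surjective_pairing.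
Qed.

(** * Splitting sets and colourings of the integers *)

Definition splits (a A : set nat) : Prop :=
  infinite_set (A `&` a) /\ infinite_set (A `\` a).

(** An increasing sequence [h] visits the sets cyclically, with two consecutive terms per visit; [a]
    collects the terms of odd index. *)
Lemma finite_splitting (A : nat -> set nat) (k : nat) :
  (forall i, (i < k)%N -> infinite_set (A i)) ->
  exists a, forall i, (i < k)%N -> splits a (A i).
Proof.
case: k => [|k]; first by exists set0.
move=> Ainf.
have pick (p : nat * nat) : exists n, (p.2 <= n)%N /\ A (p.1./2 %% k.+1)%N n.
  have /infinite_natP/(_ p.2)[n] := Ainf _ (ltn_pmod p.1./2 (ltn0Sn k)).
  by exists n.
have [next nextP] := choice pick.
pose h := fix h j := if j is j'.+1 then next (j, (h j').+1) else next (0, 0)%N.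
have hA j : A (j./2 %% k.+1)%N (h j).
  case: j => [|j]; first exact: (nextP (0, 0)%N).2.
  exact: (nextP (j.+1, (h j).+1)).2.
have h_lt : {homo h : i j / (i < j)%N}.
  apply: homo_ltn => [? ? ?|j]; first exact: ltn_trans.
  exact: (nextP (j.+1, (h j).+1)).1.
have h_ge j : (j <= h j)%N.
  by elim: j => // j IH; apply: leq_ltn_trans IH _; exact: h_lt.
have h_inj : injective h.
  by move=> i j hij; case: (ltngtP i j) => // /h_lt; rewrite hij ltnn.
exists (h @` [set j | odd j]) => i ik; split; apply/infinite_natP => N.
- exists (h (i + N * k.+1).*2.+1); first by apply: leq_trans (h_ge _); nia.
  split; last by exists (i + N * k.+1).*2.+1 => //=; rewrite odd_double.
  have := hA (i + N * k.+1).*2.+1.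
  by rewrite /= uphalf_double addnC modnMDl modn_small.
- exists (h (i + N * k.+1).*2); first by apply: leq_trans (h_ge _); nia.
  split; last by case=> j /[swap] /h_inj -> /=; rewrite odd_double.
  by have := hA (i + N * k.+1).*2; rewrite doubleK addnC modnMDl modn_small.
Qed.

(** By induction on [m]: a set [a] splitting every [A y] receives the new colour, and the infinite
    remainders outside [a] are coloured by the induction hypothesis. *)
Lemma splitting_coloring (T : Type) (Y : set T) (A : T -> set nat) (m : nat) :
  (forall B : T -> set nat, (forall y, Y y -> infinite_set (B y)) ->
    exists a, forall y, Y y -> splits a (B y)) ->
  (forall y, Y y -> infinite_set (A y)) ->
  exists g : nat -> nat, forall y i, Y y -> (i < m)%N ->
    infinite_set (A y `&` [set n | g n = i]).
Proof.
move=> split; elim: m A => [|m IH] A Ainf; first by exists id.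
have [a aA] := split _ Ainf.
have [y Yy|g gP] := IH (fun y => A y `\` a); first by have [] := aA y Yy.
exists (fun n => if pselect (a n) then m else g n) => y i Yy.
rewrite ltnS leq_eqVlt => /orP[/eqP->|im].
  have [+ _] := aA y Yy; apply: sub_infinite_set => n [An an].
  by split=> //=; case: pselect.
have := gP y i Yy im; apply: sub_infinite_set => n [[An an] /= gn].
by split=> //=; case: pselect.
Qed.

(** * Reaping families in the algebra of sets modulo finite sets *)

Local Notation piF := (\pi_Pomega_fin : set nat -> Pomega_fin).

Lemma piF_bot (A : set nat) : piF A = \bot%O <-> finite_set A.
Proof.
rewrite -[X in _ <-> X]notK infinite_natP (pi_finP A set0); split.
  move=> [N NP] /(_ N)[n /NP [+ _]]; exact.
move=> /existsNP[N NP]; exists N => n Nn; split=> // An.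
by apply: NP; exists n.
Qed.

Lemma piF_le (A B : set nat) : (piF A <= piF B)%O <-> finite_set (A `\` B).
Proof.
have -> : (piF A <= piF B)%O = (fmeet (piF A) (piF B) == piF A) by [].
rewrite fmeet_pi -piF_bot (pi_finP _ set0).
split=> [/eqP/pi_finP[N NP]|[N NP]]; [|apply/eqP/pi_finP]; exists N => n /NP;
  by rewrite /setI /setD /set0 /mkset; case: (pselect (B n)); tauto.
Qed.

Lemma piF_meet (A B : set nat) : (piF A `&` piF B)%O = piF (A `&` B).
Proof. exact: fmeet_pi. Qed.

(** A class witnessing the failure of reaping has a representative that splits every [A y]: a finite
    [A y] minus [a] would mean inclusion, a finite intersection disjointness. *)
Lemma not_reaping_splitting (T : Type) (Y : set T) (A : T -> set nat) :
  ~ is_reaping [set piF (A y) | y in Y] ->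
  (forall y, Y y -> infinite_set (A y)) ->
  exists a, forall y, Y y -> splits a (A y).
Proof.
move=> nr Ainf; apply: contrapT => nsplit; apply: nr; split.
  by move=> [y Yy /piF_bot]; exact: Ainf.
move=> q; rewrite -[q]reprK; apply: contrapT => nq; apply: nsplit.
exists (repr q) => y Yy; split=> fin; apply: nq; exists (piF (A y)).
- by exists y.
- by right; rewrite piF_meet; apply/piF_bot; rewrite setIC.
- by exists y.
- by left; apply/piF_le.
Qed.

(** Finitely many infinite sets always have a common splitting set. *)
Lemma reaping_infinite (X : set Pomega_fin) : is_reaping X -> infinite_set X.
Proof.
move=> [X0 Xr] /finite_seqP[s Xs].
have [i si|a aP] := @finite_splitting (fun i => repr (nth \bot%O s i)) (size s).
  move=> /piF_bot; rewrite reprK => s0; apply: X0.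
  by rewrite Xs -s0; exact: mem_nth.
have [x Xx] := Xr (piF a).
have xs : x \in s by move: Xx; rewrite Xs.
have := aP (index x s); rewrite index_mem nth_index// => /(_ xs)[ia ina].
rewrite -[x]reprK => -[/piF_le|]; first exact: ina.
by rewrite piF_meet setIC => /piF_bot.
Qed.

(** Ensures that [reaping_number] is a genuine minimum and not a default value. *)
Lemma reaping_exists : exists X : set Pomega_fin, is_reaping X.
Proof.
exists [set x | x <> \bot%O]; split=> [|a]; first exact.
have [->|a0] := pselect (a = \bot%O); last by exists a => //; left.
exists \top%O; last by right; rewrite meet0x.
move=> /piF_bot; exact: infinite_nat.
Qed.

Lemma reaping_numberP :
  is_least_cardinal (fun kappa => exists2 X : set Pomega_fin,
    is_reaping X & Defs.card X = kappa) reaping_number.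
Proof.
by apply: least_cardinalP; have [X Xr] := reaping_exists; exists (Defs.card X), X.
Qed.

Lemma cardinal_le_anti (c d : cardinal) :
  cardinal_le c d -> cardinal_le d c -> c = d.
Proof.
have [K ->] := cardinal_surj c; have [L ->] := cardinal_surj d.
move=> /cardinal_le_card KL /cardinal_le_card LK.
by apply/card_inj; exact: Cantor_Bernstein.
Qed.

(** * The quotient norm as a limsup *)

Section LinfModC0.
Variable R : realType.
Local Notation X := (linf_mod_c0 R).
Local Notation piX := (\pi_X : linf R -> X).

Lemma piX_surj (q : X) : exists x, piX x = q.
Proof. by exists (repr q); exact: reprK. Qed.

Lemma piXZ (a : R) (x : linf R) : piX (a *: x) = a *: piX x.
Proof. by rewrite -quot_scale_pi. Qed.

Lemma piXN (x : linf R) : piX (- x) = - piX x.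
Proof. by rewrite -scaleN1r piXZ scaleN1r. Qed.

Lemma linf_coeD (x y : linf R) n : (x + y) n = x n + y n.
Proof. by []. Qed.

Lemma linf_coeN (x : linf R) n : (- x) n = - x n.
Proof. by []. Qed.

Lemma linf_coeZ (a : R) (x : linf R) n : (a *: x) n = a * x n.
Proof. by []. Qed.

Lemma linf_of_bounded (u : nat -> R) (M : R) :
  (forall n, `|u n| <= M) -> exists x : linf R, x = u :> (nat -> R).
Proof.
move=> uM; have bu : u \in @bounded_seq R by apply/bounded_seqP; exists M.
by exists (Linf bu).
Qed.

(** A representative of nearly minimal norm differs from [x] by a null sequence; conversely, zeroing
    finitely many terms of [x] does not change its class. *)
Lemma norm_piX_le (x : linf R) (M : R) : 0 <= M ->
  `|piX x| <= M <->
  forall e, 0 < e -> exists N, forall n, (N <= n)%N -> `|x n| <= M + e.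
Proof.
move=> M0; split=> [xM e e0|xM].
  have [_ [y /= yx <-] ye] : exists2 r,
      [set `|y| | y in [set y | piX y = piX x]] r & r < M + e / 2.
    apply: inf_lt; first by exists `|x|, x.
    by rewrite (le_lt_trans xM)// ltrDl divr_gt0.
  have /pi_eqP/c0P/cvgrPdist_lt/(_ (e / 2)) := esym yx.
  rewrite divr_gt0// => /(_ isT)[N _ NP]; exists N => n /NP /=.
  rewrite sub0r normrN => xy.
  have yn : `|y n| <= `|y| := sup_norm_ub y n.
  have := ler_normD (x n - y n) (y n); rewrite subrK; lra.
apply/ler_addgt0Pr => e e0; have [N NP] := xM e e0.
have Me : 0 <= M + e by lra.
have [y yE] : exists y : linf R,
    y = (fun n => if (N <= n)%N then x n else 0) :> (nat -> R).
  by apply: (@linf_of_bounded _ (M + e)) => n; case: ifP => [/NP|]//; rewrite normr0.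
have -> : piX x = piX y.
  apply/pi_eqP/c0P/cvgrPdist_lt => d d0; exists N => // n Nn.
  by rewrite sub0r normrN linf_coeD linf_coeN yE Nn subrr normr0.
apply: le_trans (quot_norm_le _) _; apply: sup_norm_le => n.
by rewrite yE; case: ifP => [/NP|]//; rewrite normr0.
Qed.

Lemma norm_piX_gt (x : linf R) (M : R) : 0 <= M -> M < `|piX x| ->
  infinite_set [set n | M < `|x n|].
Proof.
move=> M0 Mx; apply/infinite_natP => N; apply: contrapT => noN.
have : `|piX x| <= M; last by rewrite leNgt Mx.
apply/norm_piX_le => // e e0; exists N => n Nn.
rewrite (@le_trans _ _ M) ?lerDl ?(ltW e0)// leNgt; apply/negP => Mn.
by apply: noN; exists n.
Qed.

Lemma norm_piX_ge (x : linf R) (M : R) :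
  infinite_set [set n | M <= `|x n|] -> M <= `|piX x|.
Proof.
move=> /infinite_natP Minf; rewrite leNgt; apply/negP => xM.
have [|N NP] := (norm_piX_le x (normr_ge0 (piX x))).1 (lexx _) ((M - `|piX x|) / 2).
  by rewrite divr_gt0// subr_gt0.
have [n /NP + /=] := Minf N; lra.
Qed.

(** * Upper bound: signed indicators of a reaping family *)

Lemma indicator_linf (A : set nat) :
  exists x : linf R, x = (fun n => \1_A n) :> (nat -> R).
Proof.
apply: (@linf_of_bounded _ 1) => n; rewrite indicE.
by case: (_ \in _); rewrite ?normr1 ?normr0.
Qed.

Lemma norm_indicator (A : set nat) (x : linf R) :
  infinite_set A -> x = (fun n => \1_A n) :> (nat -> R) -> `|piX x| = 1.
Proof.
move=> Ainf xE; apply/eqP; rewrite eq_le; apply/andP; split.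
  apply/norm_piX_le => // e e0; exists 0%N => n _.
  by rewrite xE indicE; case: (_ \in _); rewrite ?normr1 ?normr0; lra.
apply: norm_piX_ge; apply: sub_infinite_set Ainf => n An /=.
by rewrite xE indicE mem_set// normr1.
Qed.

Lemma unit_ball_slice : is_slice (unit_ball (X := X)).
Proof.
exists (\0 : {linear X -> R^o}), 1; split=> //; first exact: cst_continuous.
apply/seteqP; split=> x //=; last by case.
move=> x1; split=> //=.
rewrite (_ : _ @` _ = [set 0]) ?sup1; first by lra.
by apply/seteqP; split=> [_ [y _ <-]//|_ ->]; exists x.
Qed.

(** Eventually [u] is at most 5/4 in absolute value. A term of the sum above 3/2 is then impossible
    off [A], and on [A] it forces [u n] to have the sign of the indicator. *)
Lemma near_indicator_sign (A : set nat) (x u : linf R) (b : bool) :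
  x = (fun n => \1_A n) :> (nat -> R) -> `|piX u| <= 1 ->
  1 + 1 / 2 < `|(-1) ^+ b *: piX x + piX u| ->
  infinite_set (A `&` [set n | 0 < (-1) ^+ b * u n]).
Proof.
move=> xE u1; rewrite -piXZ -piD => /norm_piX_gt.
have h0 : 0 <= 1 + 1 / 2 :> R by lra.
move=> /(_ h0)/infinite_natP xu; apply/infinite_natP => N.
have [|M MP] := (norm_piX_le u ler01).1 u1 (1 / 4); first by lra.
have [n] := xu (maxn N M).
rewrite geq_max => /andP[Nn /MP un] xun; exists n => //; move: xun.
rewrite -[[set _ | _] n]/(is_true (_ < `|((-1) ^+ b *: x + u) n|)).
rewrite linf_coeD linf_coeZ xE indicE.
have [nA|_] := boolP (n \in A); last by rewrite mulr0 add0r; lra.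
rewrite mulr1 => xun; split; first exact/set_mem.
move: un xun => /=; rewrite ler_norml => /andP[un1 un2].
by rewrite lter_normr; case: b {xu} => /= /orP[]; rewrite ?expr0 ?expr1; lra.
Qed.

Lemma reaping_fails_Daugavet (F : set Pomega_fin) :
  is_reaping F -> ~ Daugavet_property X (Defs.card F).
Proof.
move=> Fr Dp; have Finf := reaping_infinite Fr.
have [F0 Frp] := Fr.
have [ind indE] := choice (fun p : Pomega_fin => indicator_linf (repr p)).
have Finf' p : F p -> infinite_set (repr p).
  by move=> Fp /piF_bot; rewrite reprK => p0; apply: F0; rewrite -p0.
pose y (pb : F * bool) : X := (-1) ^+ pb.2 *: piX (ind (val pb.1)).
have [|||q q1 qP] := Dp (range y) _ _ _ unit_ball_slice (1 / 2).
- move=> _ [[p b] _ <-] /=; rewrite /unit_sphere /= normrZ normrX normrN1.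
  rewrite expr1n mul1r (norm_indicator _ (indE _))//.
  by apply: Finf'; exact/set_mem/(valP p).
- apply/cardinal_le_card; apply: card_le_trans (card_image_le _ _) _.
  rewrite -(card_le_eqr (card_setT F)); apply/inj_card_leP/infinite_double.
  by apply/infiniteP; rewrite (card_le_eqr (card_setT F)); exact/infiniteP.
- by lra.
have [u uq] := piX_surj q; rewrite -{}uq in q1 qP.
have sgn (p : Pomega_fin) (b : bool) : F p ->
    infinite_set (repr p `&` [set n | 0 < (-1) ^+ b * u n]).
  move=> Fp; apply: (near_indicator_sign (indE p)) => //.
  have := qP (y (SigSub (mem_set Fp), b)) (imageT _ _).
  by rewrite /y /=; apply: le_lt_trans; lra.
(* Inclusion of [p] is refuted by the negative indicator, disjointness by the positive one. *)
have [p Fp] := Frp (piF [set n | 0 < u n]).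
rewrite -[p]reprK => -[/piF_le|].
  have := sgn p true Fp; apply: sub_infinite_set.
  by move=> n [pn /= un]; split=> //=; lra.
rewrite piF_meet => /piF_bot.
have := sgn p false Fp; apply: sub_infinite_set.
by move=> n [pn /= un]; split=> //=; lra.
Qed.

(** * Lower bound: changing a vector inside a slice *)

Lemma dual_bounded (f : {linear X -> R^o}) : continuous f ->
  exists2 k : R, 0 < k & forall x, `|f x| <= k * `|x|.
Proof.
move=> /linear_bounded_continuous/linear_boundedP/pinfty_ex_gt0[k k0 kP].
by exists k.
Qed.

Lemma slice_nonempty (f : {linear X -> R^o}) (a : R) : 0 < a ->
  slice_of_ball f a !=set0.
Proof.
move=> a0; have [||_ [x x1 <-] xa] := @sup_gt R (f @` unit_ball (X := X))
    (sup (f @` unit_ball (X := X)) - a).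
- by exists (f 0), 0 => //; rewrite /unit_ball /= normr0.
- by lra.
by exists x.
Qed.

(* The sum of the changes over all j < m has norm at most 2, as their supports
   are disjoint, so f cannot decrease by d along each of them. *)
Lemma small_change (f : {linear X -> R^o}) (u : linf R) (d : R) :
  continuous f -> `|piX u| <= 1 -> 0 < d ->
  exists m, forall (g : nat -> nat) (s : nat -> bool), exists2 j, (j < m)%N &
  exists v : linf R, [/\ v = (fun n => if g n == j then (-1) ^+ s n else u n)
    :> (nat -> R), `|piX v| <= 1 & f (piX u) - d < f (piX v)].
Proof.
move=> fc u1 d0; have [k k0 fk] := dual_bounded fc.
(* If every change failed, [d * m] would be at most [f] of their sum, hence at most [2 * k]. *)
have [m mP] : exists m : nat, 2 * k < d * m%:R.
  exists (Num.bound (2 * k / d)); rewrite -ltr_pdivrMl// mulrC.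
  by apply: archi_boundP; rewrite divr_ge0 ?mulr_ge0// ltW.
exists m => g s; apply: contrapT => nosmall.
have sgn1 n : `|(-1) ^+ s n| = 1 :> R by rewrite normrX normrN1 expr1n.
have u_le n : 0 <= `|u n| <= `|u| by rewrite normr_ge0; exact: sup_norm_ub.
have evu := (norm_piX_le u ler01).1 u1.
have vP j : exists v : linf R,
    v = (fun n => if g n == j then (-1) ^+ s n else u n) :> (nat -> R).
  apply: (@linf_of_bounded _ (1 + `|u|)) => n.
  by have /andP[] := u_le n; case: ifP => _; rewrite ?sgn1; lra.
(* [w i] is the sum of the changes [u - v j] over the colours [j < i]. *)
have wP i : exists w : linf R,
    w = (fun n => if (g n < i)%N then u n - (-1) ^+ s n else 0) :> (nat -> R).
  apply: (@linf_of_bounded _ (1 + `|u|)) => n.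
  have /andP[] := u_le n; have := ler_normB (u n) ((-1) ^+ s n); rewrite sgn1.
  by case: ifP => _; rewrite ?normr0; lra.
have [v vE] := choice vP; have [w wE] := choice wP.
have v1 j : `|piX (v j)| <= 1.
  apply/norm_piX_le => // e e0; have [N NP] := evu e e0.
  by exists N => n /NP; rewrite vE; case: ifP => _; rewrite ?sgn1; lra.
have w2 i : `|piX (w i)| <= 2.
  apply/norm_piX_le => // e e0; have [N NP] := evu e e0.
  exists N => n /NP; rewrite wE.
  have := ler_normB (u n) ((-1) ^+ s n); rewrite sgn1.
  by case: ifP => _; rewrite ?normr0; lra.
have f0 : f 0 = 0 :> R by exact: linear0.
have fD x y : f (x + y) = f x + f y :> R by exact: linearD.
have fB x y : f (x - y) = f x - f y :> R by exact: linearB.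
have fw i : (i <= m)%N -> d * i%:R <= f (piX (w i)).
  elim: i => [_|i IH im].
    have -> : w 0%N = 0 by apply/val_inj/funext => n; rewrite /= wE.
    by rewrite mulr0 pi0 f0.
  have -> : w i.+1 = w i + (u - v i).
    apply/val_inj/funext => n.
    rewrite -[LHS]/(w i.+1 n) -[RHS]/(w i n + (u n - v i n)) !wE vE.
    by rewrite ltnS leq_eqVlt; case: ltngtP => _ /=; lra.
  have dS : d * i.+1%:R = d * i%:R + d by rewrite -natr1 mulrDr mulr1.
  rewrite piD fD piD piXN fB dS.
  apply: lerD; first exact: IH (ltnW im).
  rewrite leNgt; apply/negP => small; apply: nosmall; exists i => //.
  exists (v i); split=> //.
  by rewrite ltrBlDr -ltrBlDl.
have := fw m (leqnn m); have := fk (piX (w m)).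
have := ler_norm (f (piX (w m))); have := w2 m.
nra.
Qed.

Lemma Daugavet_below_reaping (kappa : cardinal) :
  ~ cardinal_le reaping_number kappa -> Daugavet_property X kappa.
Proof.
move=> nr Y Ysph Yk S [f [a [fc a0 ->]]] e e0.
have [q [q1 qa]] := slice_nonempty f a0.
have [u uq] := piX_surj q; rewrite -{}uq in q1 qa.
set t := sup _ - a in qa.
have d0 : 0 < f (piX u) - t by rewrite subr_gt0.
have [m mP] := small_change fc q1 d0.
(* Below 1, so that [1 - e'] is nonnegative; strictly below [e], since the final norm estimate is
   not strict. *)
pose e' := Num.min e 1 / 2.
have [e'0 e'1 e'e] : [/\ 0 < e', e' < 1 & e' < e].
  by rewrite /e'; case: (lerP e 1) => ?; split; lra.
pose side (b : bool) (y : X) := [set n | 1 - e' < (-1) ^+ b * repr y n].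
(* The two sides together cover the infinite set where the representative exceeds [1 - e'] in
   absolute value. *)
have sideP (y : X) : exists b : bool, Y y -> infinite_set (side b y).
  apply: contrapT => /forallNP sfin.
  have [Yy fin0] := (not_implyP _ _).1 (sfin false).
  have [_ fin1] := (not_implyP _ _).1 (sfin true).
  have e'01 : 0 <= 1 - e' by lra.
  have := @norm_piX_gt (repr y) (1 - e') e'01.
  rewrite reprK (Ysph _ Yy) ltrBlDr ltrDl => /(_ e'0); apply.
  apply: (@sub_finite_set _ _ (side false y `|` side true y)).
    move=> n /=; rewrite lter_normr /side /= expr0 expr1 mul1r mulN1r.
    by move=> /orP[]; [left|right].
  by rewrite finite_setU; split; exact: contrapT.
have [sgn sgnP] := choice sideP.
have [||g gP] := @splitting_coloring _ Y (fun y => side (sgn y) y) m.*2.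
(* A reaping family indexed by [Y] would have at most [kappa] members. *)
- move=> B; apply: not_reaping_splitting => Br; apply: nr.
  have [K kK] := cardinal_surj kappa; rewrite {}kK in Yk *.
  have [_ /(_ (Defs.card _))] := reaping_numberP.
  have [L ->] := cardinal_surj reaping_number => rB.
  apply/cardinal_le_card; move/cardinal_le_card: Yk; apply: card_le_trans.
  apply: card_le_trans (card_image_le _ _); apply/cardinal_le_card/rB.
  by eexists; [exact: Br|].
- by move=> y Yy; exact: sgnP.
(* Colours [2j] and [2j + 1] form the [j]-th pair, and parity gives the sign. On colour [sgn y + 2j]
   the new vector has the sign that [y] has on its chosen side. *)
have [j jm [v [vE v1 fv]]] := mP (fun n => (g n)./2) (fun n => odd (g n)).
exists (piX v); first by split=> //; rewrite subKr in fv.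
move=> y Yy; rewrite -[y]reprK -piD; apply: (@lt_le_trans _ _ (2 - e')).
  by rewrite ltrD2l ltrN2.
apply: norm_piX_ge.
have jm2 : (sgn y + j.*2 < m.*2)%N by case: (sgn y); lia.
have := gP y (sgn y + j.*2)%N Yy jm2.
apply: sub_infinite_set => n [sn /= gn].
rewrite -[X in _ <= `|X|]/(repr y n + v n) vE gn half_bit_double eqxx.
rewrite oddD odd_double addbF oddb.
move: sn; rewrite /side /=; case: (sgn y); rewrite ?expr0 ?expr1 => sn.
  by rewrite lter_normr; apply/orP; right; lra.
by rewrite lter_normr; apply/orP; left; lra.
Qed.

End LinfModC0.

Theorem proposition5p3 (R : realType) :
  Dau (linf_mod_c0 R) = reaping_number.
Proof.
have [[F Fr Fcard] _] := reaping_numberP.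
have failr := reaping_fails_Daugavet (R := R) Fr; rewrite Fcard in failr.
(* Failure at [reaping_number] shows that [Dau] is a genuine minimum. *)
have [Dfail Dmin] := least_cardinalP (ex_intro (fun k => ~ Daugavet_property _ k) _ failr).
apply: cardinal_le_anti; first exact: Dmin.
by apply: contrapT => /(@Daugavet_below_reaping R).
Qed.
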